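(* Let $(X,d,\mu)$ be a space of homogeneous type with $\mu(X)=\infty$ and $\mu(\{x_0\})=0$ for every $x_0\in X$, and let $\mathcal D$ be a system of dyadic cubes on $X$. Given $0<\eta<1$ and a collection $\mathcal S\subset\mathcal D$ of dyadic cubes, the following statements hold: (1) if $\mathcal S$ is $\eta$-sparse, then $\mathcal S$ is $\frac c\eta$-Carleson, where $c$ is the constant denoting the amount of overlap of the sets $E_Q$ in the definition of $\eta$-sparse; (2) if $\mathcal S$ is $\frac1\eta$-Carleson, then $\mathcal S$ is $\eta$-sparse.
   Context: A space of homogeneous type $(X,d,\mu)$: $d$ is a quasi-metric on $X$ (symmetric, $d(x,y)=0$ iff $x=y$, $d(x,y)\le A_0[d(x,z)+d(z,y)]$ for some $A_0\ge1$), $\mu$ is a nonzero doubling measure: $\mu(B(x,2r))\le C_\mu\mu(B(x,r))<\infty$ for all balls $B(x,r)=\{y:d(x,y)<r\}$. A system of dyadic cubes with parameters $\delta\in(0,1)$, $0<a_1\le A_1<\infty$ is a countable family $\mathcal D=\bigcup_{k\in\mathbb Z}\mathcal D_k$, $\mathcal D_k=\{Q^k_\alpha:\alpha\in\mathcal A_k\}$, of Borel sets such that: for each $k$, $X$ is the disjoint union of the cubes in $\mathcal D_k$; if $\ell\ge k$ then either $Q^\ell_\beta\subseteq Q^k_\alpha$ or $Q^k_\alpha\cap Q^\ell_\beta=\emptyset$; for each $(k,\alpha)$ and $\ell\le k$ there is a unique $\beta$ with $Q^k_\alpha\subseteq Q^\ell_\beta$; each $Q^k_\alpha$ is the union of at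 most $M$ (a fixed constant) cubes of $\mathcal D_{k+1}$; $B(x^k_\alpha,a_1\delta^k)\subseteq Q^k_\alpha\subseteq B(x^k_\alpha,A_1\delta^k)=:B(Q^k_\alpha)$ for a centre point $x^k_\alpha\in Q^k_\alpha$; and if $\ell\ge k$ and $Q^\ell_\beta\subseteq Q^k_\alpha$ then $B(Q^\ell_\beta)\subseteq B(Q^k_\alpha)$. $\eta$-sparse ($0<\eta<1$): for every $Q\in\mathcal S$ there is a measurable $E_Q\subset Q$ with $\mu(E_Q)\ge\eta\mu(Q)$, and the sets $\{E_Q\}_{Q\in\mathcal S}$ have only finite overlap (i.e. $\sum_{Q\in\mathcal S}\chi_{E_Q}\le c$ for some constant $c$). $\Lambda$-Carleson ($\Lambda>1$): for every cube $Q\in\mathcal D$, $\sum_{P\in\mathcal S,\,P\subseteq Q}\mu(P)\le\Lambda\mu(Q)$. *)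

(* Defs.v *)
From mathcomp Require Import all_boot all_order all_algebra.
From mathcomp Require Import all_classical all_reals all_analysis.

Set Implicit Arguments.
Unset Strict Implicit.
Unset Printing Implicit Defensive.

Import Order.TTheory GRing.Theory Num.Theory.
Local Open Scope classical_set_scope.
Local Open Scope ring_scope.

Record quasi_metric (R : realType) (X : Type) (dist : X -> X -> R) : Prop :=
  QuasiMetric {
    qm_ge0 : forall x y, 0 <= dist x y ;
    qm_sym : forall x y, dist x y = dist y x ;
    qm_eq0 : forall x y, dist x y = 0 <-> x = y ;
    qm_triangle : exists2 A0 : R, 1 <= A0 &
      forall x y z, dist x y <= A0 * (dist x z + dist z y) }.

Definition qball (R : realType) (X : Type) (dist : X -> X -> R)
  (x : X) (r : R) : set X := [set y | dist x y < r].

(* The topology of a quasi-metric; for a quasi-metric, balls need not be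
   open, nor even Borel. *)
Definition qopen (R : realType) (X : Type) (dist : X -> X -> R) : set (set X) :=
  [set U | forall x, U x -> exists2 r : R, 0 < r & qball dist x r `<=` U].

Definition qborel (R : realType) (X : Type) (dist : X -> X -> R) :
  set (set X) := <<s qopen dist >>.

(* The measure lives on some sigma-algebra that contains the Borel sets and the
   balls, so that [mu] is meaningful on all of them. *)
Record homogeneous_type (R : realType) (disp : measure_display)
    (X : measurableType disp) (dist : X -> X -> R)
    (mu : {measure set X -> \bar R}) : Prop := HomogeneousType {
  ht_quasi_metric : quasi_metric dist ;
  ht_borel : qborel dist `<=` measurable ;
  ht_ball : forall x r, measurable (qball dist x r) ;
  ht_neq0 : mu [set: X] <> 0%E ;
  ht_doubling : exists C : R, forall x (r : R), 0 < r ->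
    (mu (qball dist x (2 * r)) <= C%:E * mu (qball dist x r))%E ;
  ht_ball_fin : forall x (r : R), 0 < r -> (mu (qball dist x r) < +oo)%E }.

Record dyadic_system (R : realType) (X : Type) (dist : X -> X -> R)
    (I : Type) := DyadicSystem {
  ds_delta : R ;
  ds_a1 : R ;
  ds_A1 : R ;
  ds_M : nat ;
  ds_index : int -> set I ;
  ds_cube : int -> I -> set X ;
  ds_center : int -> I -> X ;
  ds_delta_itv : 0 < ds_delta < 1 ;
  ds_radii : 0 < ds_a1 <= ds_A1 ;
  ds_countable : forall k, countable (ds_index k) ;
  ds_borel : forall k a, ds_index k a -> qborel dist (ds_cube k a) ;
  ds_cover : forall k, \bigcup_(a in ds_index k) ds_cube k a = [set: X] ;
  ds_disjoint : forall k, trivIset (ds_index k) (ds_cube k) ;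
  ds_nested : forall k l a b, k <= l -> ds_index k a -> ds_index l b ->
    ds_cube l b `<=` ds_cube k a \/ ds_cube k a `&` ds_cube l b = set0 ;
  ds_ancestor : forall k l a, l <= k -> ds_index k a ->
    exists! b, ds_index l b /\ ds_cube k a `<=` ds_cube l b ;
  ds_children : forall k a, ds_index k a ->
    exists B : set I, [/\ B `<=` ds_index (k + 1), (B #<= `I_ds_M)%card &
      ds_cube k a = \bigcup_(b in B) ds_cube (k + 1) b] ;
  ds_center_in : forall k a, ds_index k a -> ds_cube k a (ds_center k a) ;
  ds_inner_ball : forall k a, ds_index k a ->
    qball dist (ds_center k a) (ds_a1 * ds_delta ^ k) `<=` ds_cube k a ;
  ds_outer_ball : forall k a, ds_index k a ->
    ds_cube k a `<=` qball dist (ds_center k a) (ds_A1 * ds_delta ^ k) ;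
  ds_ball_nested : forall k l a b, k <= l -> ds_index k a -> ds_index l b ->
    ds_cube l b `<=` ds_cube k a ->
    qball dist (ds_center l b) (ds_A1 * ds_delta ^ l) `<=`
    qball dist (ds_center k a) (ds_A1 * ds_delta ^ k) }.

(* The cubes as sets: a set that is a cube of several generations counts once
   in sums over subcollections of [cubes D]. *)
Definition cubes (R : realType) (X : Type) (dist : X -> X -> R) (I : Type)
    (D : dyadic_system dist I) : set (set X) :=
  \bigcup_k [set ds_cube D k a | a in ds_index D k].

Definition sparse_with (R : realType) (disp : measure_display)
    (X : measurableType disp) (mu : {measure set X -> \bar R})
    (eta c : R) (S : set (set X)) : Prop :=
  exists E : set X -> set X,
    (forall Q, S Q -> [/\ measurable (E Q), E Q `<=` Q &
                          (eta%:E * mu Q <= mu (E Q))%E]) /\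
    (forall x, (\esum_(Q in S) (\1_(E Q) x)%:E <= c%:E)%E).

Definition sparse (R : realType) (disp : measure_display)
    (X : measurableType disp) (mu : {measure set X -> \bar R})
    (eta : R) (S : set (set X)) : Prop :=
  exists c : R, sparse_with mu eta c S.

(* Lambda is meant to be > 1. This is kept apart because the inequality also
   holds for smaller overlap bounds of the empty collection. *)
Definition carleson (R : realType) (disp : measure_display)
    (X : measurableType disp) (mu : {measure set X -> \bar R})
    (D : set (set X)) (Lambda : R) (S : set (set X)) : Prop :=
  forall Q, D Q ->
    (\esum_(P in [set P | S P /\ P `<=` Q]) mu P <= Lambda%:E * mu Q)%E.

(* Main.v *)
Require Import Defs.
From mathcomp Require Import all_boot all_order all_algebra.
From mathcomp Require Import all_classical all_reals all_analysis.
From mathcomp Require Import measurable_realfun.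

Set Implicit Arguments.
Unset Strict Implicit.
Unset Printing Implicit Defensive.

Import Order.TTheory GRing.Theory Num.Theory.
Local Open Scope classical_set_scope.
Local Open Scope ring_scope.

(** Both directions integrate a counting function.

    If [S] is sparse with sets [E_P] whose indicators sum to at most [c], then
    the sets [E_P] with [P] inside a cube [Q] live in [Q], so
    [eta * sum mu P <= sum mu (E_P) = \int_Q sum 1_(E_P) <= c * mu Q],
    see [carleson_of_sparse].  That the constant [c / eta] exceeds 1 comes from positivity: doubling and
    [mu X <> 0] force every ball, hence every cube, to have positive measure
    ([ball_measure_gt0]), so some [E_Q] has a point, [1 <= c], and [eta < 1].

    Conversely, let [S] be [L]-Carleson, with [L = 1 / eta] in the theorem, and
    let [h_Q x] be the number of members of [S] that contain [x] and lie in [Q]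
    (this is [depth]).  By the Carleson condition the integral of [h_Q] over [Q] is at
    most [L * mu Q], so by Markov's inequality the part of [Q] where [h_Q] reaches
    [L / (1 - eta)] has measure at most [(1 - eta) * mu Q].  Let [E_Q] be the
    rest of [Q].  The members of [S] through a fixed point [x] form a chain; if
    [M] is the largest of finitely many [Q] with [x] in [E_Q], all of them are
    counted by [h_M x], which is below [L / (1 - eta)].  The overlap is thus at
    most [L / (1 - eta)], see [shallow_overlap] and [sparse_of_carleson]. *)

(** * Exchanging countable sums and integrals *)

(** Transfers the theory of series of functions, which is indexed by natural
    numbers, to sums over a countable set [S].  An injection [S -> nat] cuts [S]
    into fibres [F n] with at most one element; fibres are used because an
    inverse enumeration would need a default element when [S] is empty. *)
Lemma esum_countable (R : realType) (J : choiceType) (S : set J) :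
  countable S -> exists F : nat -> set J,
    (forall n, F n = set0 \/ exists2 i, S i & F n = [set i]) /\
    (forall a : J -> \bar R, (forall i, (0 <= a i)%E) ->
      \esum_(i in S) a i = (\sum_(n <oo) \esum_(i in F n) a i)%E).
Proof.
move=> /countable_injP[g ginj].
exists (fun n => [set i | S i /\ g i = n]); split=> [n|a a0].
- have [->|/set0P[i [Si gi]]] := eqVneq [set i | S i /\ g i = n] set0; [by left|right].
  exists i => //; apply/seteqP; split=> [j /= [Sj gj]|j /= ->]; last by [].
  by apply: ginj; rewrite ?inE ?gi ?gj.
- rewrite -nneseries_sum_bigcup//; last by move=> m n _ _ [i [[_ <-] [_ <-]]].
  congr (esum _ _); apply/seteqP; split=> [i Si|i [n _ []]//].
  by exists (g i).
Qed.

Lemma measurable_fun_esum (R : realType) (disp : measure_display)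
    (X : measurableType disp) (D : set X) (J : choiceType) (S : set J)
    (f : J -> X -> \bar R) :
  countable S -> (forall i, S i -> measurable_fun D (f i)) ->
  (forall i x, (0 <= f i x)%E) ->
  measurable_fun D (fun x => \esum_(i in S) f i x).
Proof.
move=> /(esum_countable R)[F [F1 SF]] mf f0.
under eq_fun => x do rewrite SF//.
have -> : (fun x => \sum_(n <oo) \esum_(i in F n) f i x)%E =
          (fun x => \sum_(n <oo | n \in predT) \esum_(i in F n) f i x)%E by [].
apply: ge0_emeasurable_sum => [n x _ _|n _]; first exact: esum_ge0.
case: (F1 n) => [->|[i Si ->]].
- by under eq_fun => x do rewrite esum_set0; exact: measurable_cst.
- by under eq_fun => x do rewrite esum_set1//; exact: mf.
Qed.

Lemma integral_esum (R : realType) (disp : measure_display)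
    (X : measurableType disp) (mu : {measure set X -> \bar R}) (D : set X)
    (J : choiceType) (S : set J) (f : J -> X -> \bar R) :
  measurable D -> countable S -> (forall i, S i -> measurable_fun D (f i)) ->
  (forall i x, (0 <= f i x)%E) ->
  (\int[mu]_(x in D) (\esum_(i in S) f i x) =
   \esum_(i in S) \int[mu]_(x in D) f i x)%E.
Proof.
move=> mD /(esum_countable R)[F [F1 SF]] mf f0.
rewrite SF; last by move=> i; exact: integral_ge0.
under eq_integral => x _ do rewrite SF//.
rewrite integral_nneseries//.
- apply: eq_eseriesr => n _; case: (F1 n) => [->|[i Si ->]].
  + by rewrite esum_set0; apply: integral0_eq => x _; rewrite esum_set0.
  + rewrite esum_set1; last exact: integral_ge0.
    by under eq_integral => x _ do rewrite esum_set1//.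
- move=> n; case: (F1 n) => [->|[i Si ->]].
  + by under eq_fun => x do rewrite esum_set0; exact: measurable_cst.
  + by under eq_fun => x do rewrite esum_set1//; exact: mf.
- by move=> n x _; exact: esum_ge0.
Qed.

Lemma integral_esum_indic (R : realType) (disp : measure_display)
    (X : measurableType disp) (mu : {measure set X -> \bar R}) (Q : set X)
    (J : choiceType) (S : set J) (E : J -> set X) :
  measurable Q -> countable S ->
  (forall P, S P -> measurable (E P) /\ E P `<=` Q) ->
  (\int[mu]_(x in Q) (\esum_(P in S) (\1_(E P) x)%:E) = \esum_(P in S) mu (E P))%E.
Proof.
move=> mQ cS hE; rewrite integral_esum//.
- apply: eq_esum => P SP; have [mE EQ] := hE P SP.
  by rewrite integral_indic// setIidl.
- move=> P SP; apply/measurable_EFinP; apply: measurable_indic.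
  by have [] := hE P SP.
Qed.

(** * From sparse to Carleson *)

(** It suffices to bound the sum over each finite subfamily [A], for which
    [eta * sum mu P <= sum mu (E P) = \int_Q sum 1_(E P) <= c * mu Q]. *)
Lemma carleson_of_sparse (R : realType) (disp : measure_display)
    (X : measurableType disp) (mu : {measure set X -> \bar R})
    (F S : set (set X)) (eta c : R) :
  F `<=` measurable -> 0 < eta -> 0 <= c -> sparse_with mu eta c S ->
  carleson mu F (c / eta) S.
Proof.
move=> mF eta0 c0 [E [hE overlap]] Q FQ.
apply: ge_ereal_sup => _ [A [finA AS] <-].
have mQ := mF _ FQ.
have hA P : A P -> measurable (E P) /\ E P `<=` Q.
  by move=> /AS[SP PQ]; have [mE EP _] := hE P SP; split=> //; exact: subset_trans PQ.
rewrite mulrC EFinM -muleA lee_pdivlMl// ge0_mule_fsumr//.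
apply: (@le_trans _ _ (\sum_(P \in A) mu (E P))%E).
  by apply: lee_fsum => // P /AS[/hE[]].
rewrite -esum_fset// -(integral_esum_indic mu mQ (finite_set_countable finA) hA).
rewrite -integral_cst//; apply: ge0_le_integral => //.
- by move=> x _; apply: esum_ge0 => P _; rewrite lee_fin.
- apply: measurable_fun_esum => //; first exact: finite_set_countable.
  by move=> P /hA[mE _]; apply/measurable_EFinP; apply: measurable_indic.
- move=> x _; apply: le_trans (overlap x).
  by rewrite esum_fset//; apply: esum_ge; exists A => //; split=> // P /AS[SP _].
Qed.

(** * From Carleson to sparse *)

Lemma finite_chain_max (T : Type) (s : seq (set T)) :
  {in s &, forall P Q : set T, P `<=` Q \/ Q `<=` P} -> s != [::] ->
  exists2 M, M \in s & {in s, forall P, P `<=` M}.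
Proof.
elim: s => [//|Q s IHs] chain _; have [->|s0] := eqVneq s [::].
  by exists Q => [|P]; rewrite mem_seq1// => /eqP->.
have [|M Ms maxM] := IHs _ s0.
  by move=> P P' Ps P's; apply: chain; rewrite inE ?Ps ?P's orbT.
have [QM|MQ] : Q `<=` M \/ M `<=` Q by apply: chain; rewrite inE ?eqxx ?Ms ?orbT.
- by exists M; [rewrite inE Ms orbT|move=> P; rewrite inE => /predU1P[->|/maxM]].
- exists Q; first by rewrite mem_head.
  by move=> P; rewrite inE => /predU1P[->|/maxM PM] //; exact: subset_trans MQ.
Qed.

(** How many generations of [S] below [Q] the point [x] belongs to.  The count
    is extended-real valued, since it is infinite where generations accumulate. *)
Definition depth (R : realType) (X : Type) (S : set (set X)) (Q : set X)
  (x : X) : \bar R := \esum_(P in [set P | S P /\ P `<=` Q]) (\1_P x)%:E.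

(** Among finitely many [Q] with [x] in [E Q] there is a largest one, [M], since
    members of [S] through [x] are nested.  All of them contain [x] and lie in
    [M], so their number is at most the depth of [x] in [M]. *)
Lemma shallow_overlap (R : realType) (X : Type) (S : set (set X))
    (E : set X -> set X) (t : R) (x : X) : 0 <= t ->
  (forall P Q y, S P -> S Q -> P y -> Q y -> P `<=` Q \/ Q `<=` P) ->
  (forall Q, S Q -> E Q x -> Q x /\ (depth R S Q x <= t%:E)%E) ->
  (\esum_(Q in S) (\1_(E Q) x)%:E <= t%:E)%E.
Proof.
move=> t0 chain hE; apply: ge_ereal_sup => _ [A [finA AS] <-].
pose A' := A `&` [set Q | E Q x].
have finA' : finite_set A' by exact: finite_setIl.
rewrite -(fsbig_widen A'); last 2 first.
- exact: subIsetl.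
- by move=> Q /= [AQ nA'Q]; rewrite indicE memNset// => EQx; apply: nA'Q.
have mem_A' Q : (Q \in finmap.enum_fset (fset_set A')) = (Q \in A') by rewrite in_fset_set.
have [A'0|A'0] := eqVneq (finmap.enum_fset (fset_set A')) [::].
  by rewrite fsbig_finite// A'0 big_nil lee_fin.
have [|M] := @finite_chain_max _ (finmap.enum_fset (fset_set A')) _ A'0.
  move=> P Q; rewrite !mem_A' !inE => -[/AS SP EP] [/AS SQ EQ].
  by apply: (chain P Q x) => //; [have [] := hE P SP EP|have [] := hE Q SQ EQ].
rewrite mem_A' inE => -[/AS SM EM] maxM; have [_] := hE M SM EM.
apply: le_trans; apply: esum_ge; exists A'.
  split=> // Q A'Q; split; first by apply: AS; case: A'Q.
  by apply: maxM; rewrite mem_A' inE.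
apply: lee_fsum => // Q [/AS SQ EQ]; have [Qx _] := hE Q SQ EQ.
by rewrite !indicE !mem_set.
Qed.

(** Removing from [Q] the points of depth at least [t = L / (1 - eta)] costs at
    most a fraction [1 - eta] of its measure, by Markov's inequality applied to
    the depth, whose integral over [Q] is the Carleson sum.  What remains has
    depth below [t], which bounds the overlap by [t]. *)
Lemma sparse_of_carleson (R : realType) (disp : measure_display)
    (X : measurableType disp) (mu : {measure set X -> \bar R})
    (S : set (set X)) (L eta : R) :
  countable S -> S `<=` measurable -> (forall Q, S Q -> (mu Q < +oo)%E) ->
  (forall P Q x, S P -> S Q -> P x -> Q x -> P `<=` Q \/ Q `<=` P) ->
  0 < L -> eta < 1 -> carleson mu S L S ->
  sparse_with mu eta (L / (1 - eta)) S.
Proof.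
move=> cS mS finS chain L0 eta1 carl.
have e0 : 0 < 1 - eta by rewrite subr_gt0.
set t := L / (1 - eta); have t0 : 0 < t by exact: divr_gt0.
pose bad Q := [set x | (t%:E <= depth R S Q x)%E].
have depth_ge0 Q x : (0 <= depth R S Q x)%E.
  by apply: esum_ge0 => P _; rewrite lee_fin.
have cSQ Q : countable [set P | S P /\ P `<=` Q].
  by apply: sub_countable cS; apply: subset_card_le => P [].
have mdepth Q : measurable_fun Q (depth R S Q).
  apply: measurable_fun_esum => //.
  by move=> P [SP _]; apply/measurable_EFinP; apply: measurable_indic; exact: mS.
have mbad Q : S Q -> measurable (Q `&` bad Q).
  move=> SQ; apply: measurable_lee => //; exact: mS.
exists (fun Q => Q `\` (Q `&` bad Q)); split=> [Q SQ|x].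
- have mQ := mS _ SQ; have fQ := finS _ SQ.
  split; [exact: measurableD (mbad _ SQ)|by move=> x []|].
  have fin_Q : mu Q \is a fin_num by rewrite ge0_fin_numE.
  have mbad_le : (mu (Q `&` bad Q) <= (1 - eta)%:E * mu Q)%E.
    (* The claim is rescaled to [t * mu (bad part) <= L * mu Q]. *)
    rewrite -lee_pdivrMl// -(@lee_pmul2l _ L%:E)// muleA -EFinM -/t.
    have := @le_integral_abse _ _ _ mu Q mQ (depth R S Q) t (mdepth Q) t0.
    under [X in (_ <= X)%E -> _]eq_integral => x _ do rewrite gee0_abs//.
    rewrite integral_esum_indic//; last by move=> P [/mS mP PQ].
    under eq_set => x do rewrite gee0_abs//.
    by move=> /le_trans; apply; exact: carl.
  rewrite measureD//; last exact: mbad.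
  rewrite setIA setIid leeBrDr; last first.
    rewrite ge0_fin_numE// (le_lt_trans _ fQ)// le_measure ?inE//; exact: mbad.
  apply: le_trans (leeD2l _ mbad_le) _.
  by rewrite -muleDl// -EFinD addrC subrK mul1e.
- apply: shallow_overlap => //; first exact: ltW.
  move=> Q SQ [Qx nbad]; split=> //.
  by rewrite leNgt; apply/negP => /ltW tx; apply: nbad.
Qed.

(** * Measure and nesting of dyadic cubes *)

(** If one ball were null, doubling would make all its dilates by powers of 2
    null, and these exhaust the space. *)
Lemma ball_measure_gt0 (R : realType) (disp : measure_display)
    (X : measurableType disp) (dist : X -> X -> R)
    (mu : {measure set X -> \bar R}) (x : X) (r : R) :
  homogeneous_type dist mu -> 0 < r -> (0 < mu (qball dist x r))%E.
Proof.
move=> hX r0; rewrite lt0e measure_ge0 andbT; apply/eqP => ball0.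
have [C doubling] := ht_doubling hX.
have balls0 n : mu (qball dist x (2 ^+ n * r)) = 0%E.
  elim: n => [|n IHn]; first by rewrite expr0 mul1r.
  apply/eqP; rewrite eq_le measure_ge0 andbT exprS -mulrA.
  apply: le_trans (doubling _ _ _) _; first by rewrite mulr_gt0// exprn_gt0.
  by rewrite IHn mule0.
apply: (ht_neq0 hX); have -> : [set: X] = \bigcup_n qball dist x (2 ^+ n * r).
  apply/esym; rewrite -subTset => y _; exists (Num.bound (dist x y / r)) => //.
  by rewrite /qball /= -ltr_pdivrMr// upper_nthrootP.
have mballs n : measurable (qball dist x (2 ^+ n * r)) by exact: (ht_ball hX).
apply/negligibleP; first exact: bigcup_measurable.
by apply: negligible_bigcup => n; apply/(negligibleP mu (mballs n))/balls0.
Qed.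

Lemma countable_cubes (R : realType) (X : Type) (dist : X -> X -> R)
    (I : Type) (D : dyadic_system dist I) : countable (cubes D).
Proof.
apply: bigcup_countable => [|k _]; first exact: countableP.
by apply: sub_countable (ds_countable D k); exact: card_image_le.
Qed.

Lemma cubes_chain (R : realType) (X : Type) (dist : X -> X -> R)
    (I : Type) (D : dyadic_system dist I) (P Q : set X) (x : X) :
  cubes D P -> cubes D Q -> P x -> Q x -> P `<=` Q \/ Q `<=` P.
Proof.
move=> [k _ [a ka <-]] [l _ [b lb <-]] ax bx.
have [kl|lk] := leP k l.
- have [|disj] := ds_nested kl ka lb; first by right.
  by have : set0 x by rewrite -disj.
- have [|disj] := ds_nested (ltW lk) lb ka; first by left.
  by have : set0 x by rewrite -disj.
Qed.

Lemma measurable_cubes (R : realType) (disp : measure_display)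
    (X : measurableType disp) (dist : X -> X -> R)
    (mu : {measure set X -> \bar R}) (I : Type) (D : dyadic_system dist I) :
  homogeneous_type dist mu -> cubes D `<=` measurable.
Proof. by move=> hX _ [k _ [a ka <-]]; exact: (ht_borel hX) (ds_borel ka). Qed.

Lemma cube_measure_gt0 (R : realType) (disp : measure_display)
    (X : measurableType disp) (dist : X -> X -> R)
    (mu : {measure set X -> \bar R}) (I : Type) (D : dyadic_system dist I)
    (Q : set X) :
  homogeneous_type dist mu -> cubes D Q -> (0 < mu Q)%E.
Proof.
move=> hX DQ; have mQ := measurable_cubes hX DQ; case: DQ mQ => k _ [a ka <-] mQ.
have /andP[delta0 _] := ds_delta_itv D; have /andP[a10 _] := ds_radii D.
apply: (@lt_le_trans _ _ (mu (qball dist (ds_center D k a) (ds_a1 D * ds_delta D ^ k)))).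
  by apply: ball_measure_gt0 => //; rewrite mulr_gt0// exprz_gt0.
by apply: le_measure (ds_inner_ball ka); rewrite inE//; exact: (ht_ball hX).
Qed.

Lemma cube_measure_fin (R : realType) (disp : measure_display)
    (X : measurableType disp) (dist : X -> X -> R)
    (mu : {measure set X -> \bar R}) (I : Type) (D : dyadic_system dist I)
    (Q : set X) :
  homogeneous_type dist mu -> cubes D Q -> (mu Q < +oo)%E.
Proof.
move=> hX DQ; have mQ := measurable_cubes hX DQ; case: DQ mQ => k _ [a ka <-] mQ.
have /andP[delta0 _] := ds_delta_itv D; have /andP[a10 a1A1] := ds_radii D.
apply: (@le_lt_trans _ _ (mu (qball dist (ds_center D k a) (ds_A1 D * ds_delta D ^ k)))).
  by apply: le_measure (ds_outer_ball ka); rewrite inE//; exact: (ht_ball hX).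
by apply: (ht_ball_fin hX) => //; rewrite mulr_gt0 ?exprz_gt0// (lt_le_trans a10).
Qed.

Theorem theorem3p3 (R : realType) (disp : measure_display)
    (X : measurableType disp) (dist : X -> X -> R)
    (mu : {measure set X -> \bar R})
    (hX : homogeneous_type dist mu)
    (mu_infty : mu [set: X] = +oo%E)
    (mu_point : forall x0 : X, mu [set x0] = 0%E)
    (I : Type) (D : dyadic_system dist I)
    (eta : R) (heta : 0 < eta < 1)
    (S : set (set X)) (hS : S `<=` cubes D) :
  (forall c : R, sparse_with mu eta c S ->
     carleson mu (cubes D) (c / eta) S /\ (S !=set0 -> 1 < c / eta)) /\
  (carleson mu (cubes D) (1 / eta) S -> sparse mu eta S).
Proof.
have /andP[eta0 eta1] := heta; have mD := measurable_cubes hX (D := D); split.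
- move=> c spS; have [E [hE overlap]] := spS.
  (* [S] may be empty; [0 <= c] still holds since [X] has a point. *)
  have [x0 _] : [set: X] !=set0.
    by apply/set0P/eqP => X0; move: mu_infty; rewrite X0 measure0.
  have c0 : 0 <= c.
    by rewrite -lee_fin (le_trans _ (overlap x0))// esum_ge0// => Q _; rewrite lee_fin.
  split=> [|[Q SQ]]; first exact: carleson_of_sparse.
  have [mE _ muE] := hE Q SQ.
  have [x Ex] : E Q !=set0.
    apply/set0P/eqP => EQ0; move: muE; rewrite EQ0 measure0 leNgt => /negP; apply.
    by rewrite mule_gt0// (cube_measure_gt0 hX (hS _ SQ)).
  rewrite ltr_pdivlMr// mul1r (lt_le_trans eta1)// -lee_fin.
  apply: le_trans (overlap x); apply: esum_ge; exists [set Q].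
    by split=> // _ ->.
  by rewrite fsbig_set1 indicE mem_set.
- move=> carl; exists (1 / eta / (1 - eta)); apply: sparse_of_carleson => //.
  + by apply: sub_countable (countable_cubes D); exact: subset_card_le.
  + exact: subset_trans mD.
  + by move=> Q /hS; exact: cube_measure_fin.
  + by move=> P Q x /hS DP /hS DQ; exact: (cubes_chain DP DQ).
  + by rewrite divr_gt0.
  + by move=> Q /hS; exact: carl.
Qed.
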